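(* Let $F$ be a non-archimedean local field whose residue field $k$ has cardinality $q$ and characteristic $p$, let $G=\mathrm{GL}_2(F)$, $G_f=\mathrm{GL}_2(k)$, $K=\mathrm{GL}_2(\mathcal{O}_F)$, and let $R$ be an algebraically closed field of characteristic $l\neq p$, with $l$ odd dividing $q+1$. Let $\mathcal{I}_f$ and $\mathcal{I}$ be the annihilator ideals defined in the context. Then $$\mathrm{I}_{G_f,K}^{G}\,\mathcal{I}_f\subseteq\mathcal{I}$$ as subsets of the global Hecke algebra $\mathsf{H}(G)$.
   Context: Let $K^1=\ker(K\to G_f)$, $I_f\subset G_f$ the upper triangular matrices, and $I\subset K$ the preimage of $I_f$. $\mathsf{H}(G)$ is the algebra of locally constant compactly supported functions $G\to R$ under convolution, with respect to the $R$-valued Haar measure $\mu$ with $\mu(K^1)=1$; smooth $R$-representations of $G$ are nondegenerate $\mathsf{H}(G)$-modules. $\mathsf{H}(G_f)=R[G_f]$ is the group algebra. $\mathcal{I}$ is the annihilator in $\mathsf{H}(G)$ of $\mathrm{ind}_I^G\mathbf 1$ (compact induction). $\mathcal{I}_f$ is the annihilator in $\mathsf{H}(G_f)$ of $\mathrm{ind}_{I_f}^{G_f}\mathbf 1$ (equivalently of $\mathbf 1\oplus\mathrm{ind}_{I_f}^{G_f}\mathbf 1$); being a two-sided ideal, it is viewed as a representation of $G_f$ by left multiplication. Parahoric induction is $\mathrm{I}_{G_f,K}^{G}\pi=\mathrm{ind}_K^G\mathrm{infl}_{G_f}^K\pi$, which in module terms is $\mathsf{H}(G)\otimes_{\mathsf{H}(K)}\pi$,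 where $\mathsf{H}(K)\subset \mathsf{H}(G)$ is the subalgebra of functions supported on $K$, and $\mathsf{H}(G_f)$ is identified with $1_{K^1}\mathsf{H}(K)1_{K^1}$ via $g\leftrightarrow 1_{gK^1}$ (indicator function of the coset). The module $\mathrm{I}_{G_f,K}^G\mathcal{I}_f=\mathsf{H}(G)\otimes_{\mathsf{H}(K)}\mathcal{I}_f$ is regarded as a subset of $\mathsf{H}(G)$ via $h\otimes g\mapsto h*1_{gK^1}$, i.e. it is the left ideal of $\mathsf{H}(G)$ generated by the image of $\mathcal{I}_f$ under $g\mapsto 1_{gK^1}$. *)

(* Defs.v *)
From HB Require Import structures.
From mathcomp Require Import all_boot all_order all_algebra all_fingroup.
From mathcomp Require Import all_classical all_reals all_analysis.
Set Implicit Arguments.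
Unset Strict Implicit.
Unset Printing Implicit Defensive.
Import Order.TTheory GRing.Theory Num.Theory.
Local Open Scope classical_set_scope.
Local Open Scope ring_scope.

(* [v x >= n], with the convention [v 0 = +oo]: the value of [v : F -> int]
   at 0 is junk and is never used. *)
Definition val_ge (F : zmodType) (v : F -> int) (n : int) (x : F) : bool :=
  (x == 0) || (n <= v x).

(* A non-archimedean local field: a field complete for a normalised discrete
   valuation, with finite residue field, carrying the valuation topology. The
   residue field is any finite field [k] with a surjective ring morphism from
   the valuation ring onto it whose kernel is the maximal ideal; that morphism
   is encoded as a total function, unconstrained outside the valuation ring. *)
HB.mixin Record isNonarchLocalField (k : finFieldType) F
    of GRing.Field F & Topological F := {
  valuation : F -> int ;
  valuationM : forall x y : F, x != 0 -> y != 0 ->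
    valuation (x * y) = valuation x + valuation y ;
  valuationD : forall (n : int) (x y : F),
    val_ge valuation n x -> val_ge valuation n y -> val_ge valuation n (x + y) ;
  valuation_uniformizer : exists2 x : F, x != 0 & valuation x = 1 ;
  nbhs_valuation : forall x : F, nbhs x =
    [set A | exists n : int, [set y | val_ge valuation n (y - x)] `<=` A] ;
  valuation_complete : forall u : nat -> F,
    (forall n : int, exists N : nat, forall i j : nat,
       (N <= i)%N -> (N <= j)%N -> val_ge valuation n (u i - u j)) ->
    exists x : F, u @ \oo --> x ;
  residue : F -> k ;
  residue1 : residue 1 = 1 ;
  residueD : {in val_ge valuation 0 &, {morph residue : x y / x + y}} ;
  residueM : {in val_ge valuation 0 &, {morph residue : x y / x * y}} ;
  residue_surj : forall a : k, exists2 x : F, val_ge valuation 0 x & residue x = a ;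
  residue_ker : forall x : F, val_ge valuation 0 x ->
    (residue x == 0) = val_ge valuation 1 x
}.

#[short(type="nonarchLocalFieldType")]
HB.structure Definition NonarchLocalField (k : finFieldType) :=
  {F of isNonarchLocalField k F & GRing.Field F & Topological F}.

Section GL2_group.
Variable F : fieldType.

(* The library's {'GL_n[_]} only covers finite rings. *)
Record GL2 := MkGL2 { gl2_mx : 'M[F]_2 ; gl2_unit : gl2_mx \in unitmx }.

HB.instance Definition _ := [isSub for gl2_mx].
HB.instance Definition _ := [Choice of GL2 by <:].

Definition gl2_one : GL2 := MkGL2 (unitmx1 F 2).

Lemma gl2_mul_subproof (g h : GL2) : gl2_mx g *m gl2_mx h \in unitmx.
Proof. by rewrite unitmx_mul !gl2_unit. Qed.
Definition gl2_mul (g h : GL2) : GL2 := MkGL2 (gl2_mul_subproof g h).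

Lemma gl2_inv_subproof (g : GL2) : invmx (gl2_mx g) \in unitmx.
Proof. by rewrite unitmx_inv gl2_unit. Qed.
Definition gl2_inv (g : GL2) : GL2 := MkGL2 (gl2_inv_subproof g).

Lemma gl2_mulA : associative gl2_mul.
Proof. by move=> a b c; apply: val_inj; rewrite /= mulmxA. Qed.
Lemma gl2_mul1 : left_id gl2_one gl2_mul.
Proof. by move=> a; apply: val_inj; rewrite /= mul1mx. Qed.
Lemma gl2_mulr1 : right_id gl2_one gl2_mul.
Proof. by move=> a; apply: val_inj; rewrite /= mulmx1. Qed.
Lemma gl2_mulV : left_inverse gl2_one gl2_inv gl2_mul.
Proof. by move=> a; apply: val_inj; rewrite /= mulVmx // gl2_unit. Qed.
Lemma gl2_mulrV : right_inverse gl2_one gl2_inv gl2_mul.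
Proof. by move=> a; apply: val_inj; rewrite /= mulmxV // gl2_unit. Qed.

HB.instance Definition _ :=
  isGroup.Build GL2 gl2_mulA gl2_mul1 gl2_mulr1 gl2_mulV gl2_mulrV.

End GL2_group.

(* The subspace topology of GL_2(F) in M_2(F). *)
HB.instance Definition _ (k : finFieldType) (F : nonarchLocalFieldType k) :=
  Topological.copy (GL2 F) (initial_topology (@gl2_mx F)).

Section Hecke.
Variables (k : finFieldType) (F : nonarchLocalFieldType k) (R : closedFieldType).

Local Notation G := (GL2 F).
Local Notation Gf := {'GL_2[k]}.
Local Notation integral_mx :=
  (fun A : 'M[F]_2 => forall i j, val_ge (@valuation k F) 0 (A i j)).

Definition maxK : set G :=
  [set g | integral_mx (gl2_mx g) /\ integral_mx (gl2_mx (g^-1)%g)].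

(* The fibre of K -> G_f over [u], i.e. the coset gK^1 for any lift g of [u]. *)
Definition coset_K1 (u : Gf) : set G :=
  [set g | maxK g /\ map_mx (@residue k F) (gl2_mx g) = GLval u].

Definition K1 : set G := coset_K1 1%g.

(* [is_trig_mx] means lower triangular. *)
Definition borel_f : set Gf := [set u | is_trig_mx (GLval u)^T].

Definition iwahori : set G := \bigcup_(u in borel_f) coset_K1 u.

Definition is_subgroup (U : set G) : Prop :=
  U 1%g /\ (forall x y, U x -> U y -> U (x * y^-1)%g).

Definition hecke : set (G -> R) :=
  [set f : G -> R | (forall x, \forall y \near x, f y = f x) /\
           compact (closure [set x | f x != 0])].

(* An R-valued (left) Haar measure, in the sense of an invariant linear form
   on the locally constant compactly supported functions, normalised on K^1;
   the values of [mu] on other functions are irrelevant. *)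
Record haar_measure (mu : (G -> R) -> R) : Prop := {
  haar_linear : forall (a : R) (f g : G -> R), hecke f -> hecke g ->
    mu (fun x => a * f x + g x) = a * mu f + mu g ;
  haar_left_invariant : forall (g : G) (f : G -> R), hecke f ->
    mu (fun x => f (g * x)%g) = mu f ;
  haar_K1 : mu (\1_K1) = 1
}.

Definition convolution (mu : (G -> R) -> R) (f h : G -> R) : G -> R :=
  fun x => mu (fun y => f y * h (y^-1 * x)%g).

(* ind_I^G 1, on which G acts by right translation. *)
Definition ind_iwahori : set (G -> R) :=
  [set f : G -> R | [/\ forall i x, iwahori i -> f (i * x)%g = f x,
               exists U, [/\ open U, is_subgroup U &
                             forall x u, U u -> f (x * u)%g = f x] &
               exists C, compact C /\ forall x, f x != 0 ->
                 exists i c, [/\ iwahori i, C c & x = (i * c)%g]]].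

(* h . f = \int_G h(g) (g . f) dmu(g) *)
Definition hecke_act (mu : (G -> R) -> R) (h f : G -> R) : G -> R :=
  fun x => mu (fun g => h g * f (x * g)%g).

Definition ann_ind (mu : (G -> R) -> R) : set (G -> R) :=
  [set h | hecke h /\
           forall f, ind_iwahori f -> forall x, hecke_act mu h f x = 0].

(* ind_{I_f}^{G_f} 1, on which G_f acts by right translation. *)
Definition ind_borel_f : set (Gf -> R) :=
  [set f | forall b x, borel_f b -> f (b * x)%g = f x].

(* [a : {ffun Gf -> R}] stands for the element \sum_g a(g) g of R[G_f]. *)
Definition ann_ind_f : set {ffun Gf -> R} :=
  [set a : {ffun Gf -> R} | forall f, ind_borel_f f ->
           forall x, \sum_(g : Gf) a g * f (x * g)%g = 0].

(* The linear extension of g |-> 1_{gK^1}. *)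
Definition hecke_of_f (a : {ffun Gf -> R}) : G -> R :=
  fun x => \sum_(g : Gf) a g * \1_(coset_K1 g) x.

(* The image in H(G) of H(G) \otimes_{H(K)} J under
   h \otimes g |-> h * 1_{gK^1}. *)
Definition parahoric_ind (mu : (G -> R) -> R) (J : set {ffun Gf -> R}) :
    set (G -> R) :=
  [set f | exists n (h : 'I_n -> G -> R) (a : 'I_n -> {ffun Gf -> R}),
     (forall i, hecke (h i) /\ J (a i)) /\
     f = fun x => \sum_(i < n) convolution mu (h i) (hecke_of_f (a i)) x].

End Hecke.

Arguments ann_ind_f k R : clear implicits.

(* Main.v *)
(* Since (h * a~).f = h.(a~.f), it suffices that the inflation a~ to K of each
   a in I_f kills f in ind_I^G 1.  Now (a~.f)(x) is the sum over u in G_f of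
   a(u) Phi(x z_u), where z_u in K lifts u and Phi(x) is the integral of f(xy)
   over y in K^1; Phi is left I-invariant and right K^1-invariant.  By row and
   column operations x can be taken diagonal modulo I on the left and K on the
   right, and then the image in G_f of the intersection of K and x^-1 I x
   contains a conjugate w^-1 B w of the Borel subgroup B = I_f.  Hence
   v |-> Phi(x z_(w^-1 v)) lies in ind_B^(G_f) 1, which a annihilates.
   For the first step, h is a finite combination of indicators of cosets gU of a
   small congruence subgroup U of K^1, and 1_(gU) * a~ is a multiple of the
   translate of a~ by g, so no Fubini theorem is needed.  The integers of F,
   hence K^1, are compact by completeness and finiteness of k. *)
Require Import Defs.
From HB Require Import structures.
From mathcomp Require Import all_boot all_order all_algebra all_fingroup.
From mathcomp Require Import all_classical all_reals all_analysis.
From mathcomp Require Import ring.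
Set Implicit Arguments.
Unset Strict Implicit.
Unset Printing Implicit Defensive.
Import Order.TTheory GRing.Theory Num.Theory.
Local Open Scope classical_set_scope.
Local Open Scope ring_scope.

(** * Two-by-two matrices by entries *)

Lemma ord2P (P : 'I_2 -> Prop) : P 0 -> P 1 -> forall i, P i.
Proof.
move=> P0 P1 [[|[|//]] lti].
  by rewrite (_ : Ordinal lti = 0) //; apply: val_inj.
by rewrite (_ : Ordinal lti = 1) //; apply: val_inj.
Qed.

Lemma det_mx2 (A : comNzRingType) (M : 'M[A]_2) :
  \det M = M 0 0 * M 1 1 - M 0 1 * M 1 0.
Proof.
have lift01 : lift (0 : 'I_2) (0 : 'I_1) = 1 by apply: val_inj.
have lift10 : lift (1 : 'I_2) (0 : 'I_1) = 0 by apply: val_inj.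
rewrite (expand_det_row _ 0) !big_ord_recl big_ord0 addr0 lift01.
by rewrite /cofactor !det_mx11 !mxE lift01 lift10 /= expr1 expr0; ring.
Qed.

Lemma mulmx2E (A : nzRingType) (M N : 'M[A]_2) i j :
  (M *m N) i j = M i 0 * N 0 j + M i 1 * N 1 j.
Proof.
rewrite mxE !big_ord_recl big_ord0 addr0.
by have -> : lift (0 : 'I_2) (0 : 'I_1) = 1 by apply: val_inj.
Qed.

(** Explicit entries let matrix identities be settled by [ring] or [field] in each of the four
    positions. *)
Definition mx2 (A : Type) (a b c d : A) : 'M[A]_2 :=
  \matrix_(i, j) if i == 0 then (if j == 0 then a else b)
                 else (if j == 0 then c else d).

Lemma mx2_mul (A : comNzRingType) (a b c d a' b' c' d' : A) :
  mx2 a b c d *m mx2 a' b' c' d' =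
  mx2 (a * a' + b * c') (a * b' + b * d') (c * a' + d * c') (c * b' + d * d').
Proof.
by apply/matrixP => i j; rewrite mulmx2E !mxE; elim/ord2P: i; elim/ord2P: j.
Qed.

Lemma mx2_map (A B : Type) (f : A -> B) (a b c d : A) :
  map_mx f (mx2 a b c d) = mx2 (f a) (f b) (f c) (f d).
Proof.
by apply/matrixP => i j; rewrite !mxE; elim/ord2P: i; elim/ord2P: j.
Qed.

Lemma mx2_eta (A : Type) (M : 'M[A]_2) :
  M = mx2 (M 0 0) (M 0 1) (M 1 0) (M 1 1).
Proof.
by apply/matrixP => i j; rewrite !mxE; elim/ord2P: i; elim/ord2P: j.
Qed.

Lemma mx2_1 (A : nzRingType) : 1%:M = mx2 1 0 0 1 :> 'M[A]_2.
Proof. by rewrite [LHS]mx2_eta !mxE. Qed.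

Lemma mx2_det (A : comNzRingType) (a b c d : A) :
  \det (mx2 a b c d) = a * d - b * c.
Proof. by rewrite det_mx2 !mxE. Qed.

(** * The valuation ring *)

Section Valuation.
Variables (k : finFieldType) (F : nonarchLocalFieldType k).
Implicit Types (x y : F) (m n : int) (A B : 'M[F]_2).

Local Notation v := (@valuation k F).
Local Notation vge := (val_ge (@valuation k F)).
Local Notation res := (@residue k F).

Lemma valM x y : x != 0 -> y != 0 -> v (x * y) = v x + v y.
Proof. exact: valuationM. Qed.

Lemma val1 : v 1 = 0.
Proof.
by apply: (addrI (v 1)); rewrite addr0 -valM ?oner_eq0 // mulr1.
Qed.

Lemma valN1 : v (-1) = 0.
Proof.
have N1 : -1 != 0 :> F by rewrite oppr_eq0 oner_eq0.
have := valM N1 N1; rewrite mulrNN mulr1 val1 => /esym/eqP.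
by rewrite -mulr2n mulrn_eq0 /= => /eqP.
Qed.

Lemma valV x : x != 0 -> v x^-1 = - v x.
Proof.
move=> x0; apply: (addrI (v x)).
by rewrite -valM ?invr_eq0 // divff // val1 subrr.
Qed.

Lemma val_ge0 n : vge n 0.
Proof. by rewrite /val_ge eqxx. Qed.

Lemma val_geE n x : x != 0 -> vge n x = (n <= v x).
Proof. by rewrite /val_ge => /negPf ->. Qed.

Lemma val_geW m n x : m <= n -> vge n x -> vge m x.
Proof.
move=> mn /orP[/eqP ->|nv]; first exact: val_ge0.
by rewrite /val_ge (le_trans mn nv) orbT.
Qed.

Lemma val_geD n x y : vge n x -> vge n y -> vge n (x + y).
Proof. exact: valuationD. Qed.

Lemma val_geM m n x y : vge m x -> vge n y -> vge (m + n) (x * y).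
Proof.
have [->|x0] := eqVneq x 0; first by rewrite mul0r !val_ge0.
have [->|y0] := eqVneq y 0; first by rewrite mulr0 !val_ge0.
by rewrite !val_geE ?mulf_neq0 // valM // => ? ?; rewrite lerD.
Qed.

Lemma val_ge1 : vge 0 1.
Proof. by rewrite val_geE ?oner_eq0 // val1. Qed.

Lemma val_geN n x : vge n (- x) = vge n x.
Proof.
suff H y : vge n y -> vge n (- y) by apply/idP/idP => /H; rewrite ?opprK.
move=> ny; rewrite -mulN1r -[n]add0r; apply: val_geM => //.
by rewrite val_geE ?oppr_eq0 ?oner_eq0 // valN1.
Qed.

Lemma val_geB n x y : vge n x -> vge n y -> vge n (x - y).
Proof. by move=> nx ny; apply: val_geD; rewrite ?val_geN. Qed.

Lemma val_geMl n x y : vge 0 x -> vge n y -> vge n (x * y).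
Proof. by move=> x0 y0; rewrite -[n]add0r; apply: val_geM. Qed.

Lemma val_geMr n x y : vge n x -> vge 0 y -> vge n (x * y).
Proof. by rewrite mulrC => ? ?; apply: val_geMl. Qed.

Lemma val_ge01 x : vge 1 x -> vge 0 x.
Proof. exact: val_geW. Qed.

Lemma resD x y : vge 0 x -> vge 0 y -> res (x + y) = res x + res y.
Proof. exact: residueD. Qed.

Lemma resM x y : vge 0 x -> vge 0 y -> res (x * y) = res x * res y.
Proof. exact: residueM. Qed.

Lemma res1 : res 1 = 1.
Proof. exact: residue1. Qed.

Lemma res_eq0 x : vge 0 x -> (res x == 0) = vge 1 x.
Proof. exact: residue_ker. Qed.

Lemma res0 : res 0 = 0.
Proof. by apply/eqP; rewrite res_eq0 ?val_ge0. Qed.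

Lemma resN x : vge 0 x -> res (- x) = - res x.
Proof.
by move=> x0; apply: (addrI (res x)); rewrite -resD ?val_geN // !subrr res0.
Qed.

Lemma resB x y : vge 0 x -> vge 0 y -> res (x - y) = res x - res y.
Proof. by move=> ? ?; rewrite resD ?resN ?val_geN. Qed.

Lemma res_eq x y : vge 0 x -> vge 0 y -> (res x == res y) = vge 1 (x - y).
Proof. by move=> ? ?; rewrite -subr_eq0 -resB // res_eq0 // val_geB. Qed.

Lemma res_unit x : vge 0 x -> res x != 0 -> x != 0 /\ v x = 0.
Proof.
move=> x0 rx; have nx0 : x != 0 by apply: contraNneq rx => ->; rewrite res0.
split=> //; move: x0 rx => /[dup] x0; rewrite res_eq0 // !val_geE // -ltNge.
by rewrite -[1]add0r ltzD1 => ? ?; apply: le_anti; apply/andP.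
Qed.

Lemma exists_residue (a : k) : exists2 x, vge 0 x & res x = a.
Proof. exact: residue_surj. Qed.

Lemma val_ge_quot n x y : y != 0 -> vge (v y + n) x = vge n (x / y).
Proof.
move=> y0; have [->|x0] := eqVneq x 0; first by rewrite mul0r !val_ge0.
by rewrite !val_geE ?mulf_neq0 ?invr_eq0 // valM ?invr_eq0 // valV // lerBrDl.
Qed.

Definition integral A := forall i j, vge 0 (A i j).

Lemma integral_mul A B : integral A -> integral B -> integral (A *m B).
Proof. by move=> iA iB i j; rewrite mulmx2E; apply: val_geD; exact: val_geMl. Qed.

Lemma integral1 : integral 1%:M.
Proof.
by move=> i j; rewrite mxE; case: (i == j); rewrite ?val_ge1 ?val_ge0.
Qed.

Lemma integral_mx2 (a b c d : F) : vge 0 a -> vge 0 b -> vge 0 c -> vge 0 d ->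
  integral (mx2 a b c d).
Proof.
by move=> *; move=> i j; rewrite mxE; elim/ord2P: i; elim/ord2P: j.
Qed.

Lemma val_det A : integral A -> vge 0 (\det A).
Proof.
by move=> iA; rewrite det_mx2; apply: val_geB; exact: val_geMl.
Qed.

Lemma res_det A : integral A -> res (\det A) = \det (map_mx res A).
Proof.
move=> iA; rewrite !det_mx2 !mxE.
by rewrite resB ?resM //; exact: val_geMl.
Qed.

Lemma res_mulmx A B : integral A -> integral B ->
  map_mx res (A *m B) = map_mx res A *m map_mx res B.
Proof.
move=> iA iB; apply/matrixP => i j; rewrite mxE !mulmx2E !mxE.
by rewrite resD ?resM //; exact: val_geMl.
Qed.

Lemma res_mx1 : map_mx res 1%:M = 1%:M :> 'M[k]_2.
Proof. by rewrite mx2_1 mx2_map res0 res1 mx2_1. Qed.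

(** Cramer's rule: the cofactors are entries of A up to sign, and the determinant they are divided
    by is a unit. *)
Lemma integral_inv A : integral A -> \det A != 0 -> v (\det A) = 0 ->
  integral (invmx A).
Proof.
move=> iA d0 vd i j.
rewrite /invmx unitmxE unitfE d0 !mxE /cofactor det_mx11 !mxE.
apply: val_geMl; first by rewrite val_geE ?invr_eq0 // valV // vd.
apply: val_geMl => //; elim: (_ + _)%N => [|n IHn]; first exact: val_ge1.
by rewrite exprS mulN1r val_geN.
Qed.

End Valuation.

(** * Double cosets of the Iwahori subgroup *)

Lemma gl2M (E : fieldType) (g h : GL2 E) :
  gl2_mx (g * h)%g = gl2_mx g *m gl2_mx h.
Proof. by []. Qed.

Lemma gl2V (E : fieldType) (g : GL2 E) : gl2_mx g^-1%g = invmx (gl2_mx g).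
Proof. by []. Qed.

Lemma gl2_inj (E : fieldType) : injective (@gl2_mx E).
Proof. exact: val_inj. Qed.

Lemma gl2_det (E : fieldType) (g : GL2 E) : \det (gl2_mx g) != 0.
Proof. by have := gl2_unit g; rewrite unitmxE unitfE. Qed.

Lemma exists_gl2 (E : fieldType) (M : 'M[E]_2) :
  \det M != 0 -> exists g : GL2 E, gl2_mx g = M.
Proof.
move=> d; have uM : M \in unitmx by rewrite unitmxE unitfE.
by exists (MkGL2 uM).
Qed.

Lemma exists_GLval (k : finFieldType) (M : 'M[k]_2) :
  \det M != 0 -> exists u : {'GL_2[k]}, GLval u = M.
Proof.
move=> d; have uM : M \is a GRing.unit by rewrite -[_ \is a _]unitmxE unitmxE unitfE.
by exists (FinRing.Unit uM).
Qed.

Lemma GL2_det (k : finFieldType) (u : {'GL_2[k]}) :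
  \det (GLval u : 'M[k]_2) != 0.
Proof. exact: (GL_det u). Qed.

Lemma GL2_M (k : finFieldType) (u w : {'GL_2[k]}) :
  GLval (u * w)%g = GLval u *m GLval w :> 'M[k]_2.
Proof. by []. Qed.

Lemma GL2_1 (k : finFieldType) : GLval (1 : {'GL_2[k]})%g = 1%:M :> 'M[k]_2.
Proof. by []. Qed.

Lemma GLval_inj (k : finFieldType) (u w : {'GL_2[k]}) :
  GLval u = GLval w :> 'M[k]_2 -> u = w.
Proof. by move=> uw; apply: val_inj. Qed.

(** * Reduction from K to G_f, its fibres, and representatives modulo I and K *)

Section Reduction.
Variables (k : finFieldType) (F : nonarchLocalFieldType k).
Local Notation v := (@valuation k F).
Local Notation vge := (val_ge (@valuation k F)).
Local Notation res := (@residue k F).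
Local Notation G := (GL2 F).
Local Notation Gf := {'GL_2[k]}.
Implicit Types (x y g h i : G) (u w b : Gf) (M : 'M[F]_2).

Lemma coset_mul u w g h :
  coset_K1 u g -> coset_K1 w h -> coset_K1 (u * w)%g (g * h)%g.
Proof.
move=> [[ig iVg] gu] [[ih iVh] hw]; split; last first.
  by rewrite gl2M res_mulmx // gu hw.
by split; rewrite ?invMg gl2M; exact: integral_mul.
Qed.

Lemma coset_inj u w g : coset_K1 u g -> coset_K1 w g -> u = w.
Proof. by move=> [_ gu] [_ gw]; apply: val_inj; rewrite /= -gu. Qed.

(** The residue of det M is the determinant of the reduction, so det M is a unit and M has an
    integral inverse. The elements of K used below are built this way. *)
Lemma coset_of_mx M : integral M -> \det (map_mx res M) != 0 ->
  exists g u, [/\ gl2_mx g = M, GLval u = map_mx res M & coset_K1 u g].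
Proof.
move=> iM dM; have [nd vd] : \det M != 0 /\ v (\det M) = 0.
  by apply: res_unit; [exact: val_det | rewrite res_det].
have [g gM] := exists_gl2 nd; have [u uM] := exists_GLval dM.
exists g, u; split=> //; split; last by rewrite gM uM.
by split; rewrite ?gl2V gM //; exact: integral_inv.
Qed.

Lemma coset_lift u : exists g : G, coset_K1 u g.
Proof.
pose f a := s2val (cid2 (@exists_residue _ F a)).
have fr a : res (f a) = a by rewrite /f; case: cid2.
have f0 a : vge 0 (f a) by rewrite /f; case: cid2.
have rM : map_mx res (map_mx f (GLval u)) = GLval u.
  by apply/matrixP => i j; rewrite !mxE fr.
have [||g [w [_ wE gw]]] := @coset_of_mx (map_mx f (GLval u)) _ _.
- by move=> i j; rewrite mxE.
- by rewrite rM GL2_det.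
by exists g; rewrite -(_ : w = u) //; apply: val_inj; rewrite /= wE rM.
Qed.

(** Reducing g g^-1 = 1 shows that the reduction of g is invertible. *)
Lemma maxK_coset g : maxK g -> exists u, coset_K1 u g.
Proof.
move=> [ig iVg]; have [|h [u [hg uE hu]]] := @coset_of_mx (gl2_mx g) ig _.
  have : map_mx res (gl2_mx g *m gl2_mx g^-1%g) = 1%:M.
    by rewrite -gl2M mulgV res_mx1.
  rewrite res_mulmx // => /(congr1 determinant); rewrite det_mulmx det1.
  by apply: contra_eq_neq => ->; rewrite mul0r eq_sym oner_eq0.
by exists u; rewrite -(gl2_inj hg).
Qed.

(** The element g^-1 lies over some w, and u w = 1 because g g^-1 = 1 lies over 1. *)
Lemma coset_inv u g : coset_K1 u g -> coset_K1 u^-1%g g^-1%g.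
Proof.
move=> /[dup] gu [[ig iVg] _].
have [|w gw] := @maxK_coset g^-1%g; first by split; rewrite ?invgK.
suff -> : (u^-1)%g = w by [].
apply: (mulgI u); rewrite mulgV; apply: (@coset_inj _ _ 1%g).
  by split; [split; rewrite ?invg1; exact: integral1 | exact: res_mx1].
by rewrite -(mulgV g); exact: coset_mul.
Qed.

Lemma coset_mulK1 u g h : coset_K1 u g -> K1 h -> coset_K1 u (g * h)%g.
Proof. by move=> gu h1; rewrite -[u]mulg1; exact: coset_mul. Qed.

Lemma coset_lK1 u g h : K1 h -> coset_K1 u (h * g)%g <-> coset_K1 u g.
Proof.
move=> h1; split=> gu; rewrite -[u]mul1g; last exact: coset_mul.
by rewrite -(mulKg h g) -{1}(invg1); apply: coset_mul => //; exact: coset_inv.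
Qed.

Lemma coset_rK1 u g h : K1 h -> coset_K1 u (g * h)%g <-> coset_K1 u g.
Proof.
move=> h1; split=> gu; last exact: coset_mulK1.
rewrite -(mulgK h g); apply: coset_mulK1 => //.
by rewrite /K1 -invg1; exact: coset_inv.
Qed.

Lemma coset_shift u g h : coset_K1 u g -> coset_K1 u (g * h)%g <-> K1 h.
Proof.
move=> gu; split=> [gh|]; last exact: coset_mulK1.
by rewrite -(mulKg g h) /K1 -(mulVg u); apply: coset_mul => //; exact: coset_inv.
Qed.

Lemma borel_fE u : borel_f u <-> GLval u 1 0 = 0.
Proof.
split=> [/is_trig_mxP/(_ 0 1 isT)|u0]; first by rewrite mxE.
by apply/is_trig_mxP => i j; rewrite mxE; elim/ord2P: i; elim/ord2P: j.
Qed.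

Lemma borel_fM u w : borel_f u -> borel_f w -> borel_f (u * w)%g.
Proof.
move=> /borel_fE u0 /borel_fE w0; apply/borel_fE.
by rewrite GL2_M mulmx2E u0 w0 mul0r mulr0 addr0.
Qed.

Lemma borel_fV u : borel_f u -> borel_f u^-1%g.
Proof.
move=> /borel_fE u0; apply/borel_fE; apply/eqP.
(* This entry equals the lower left entry of u^-1 times u_00, and u_00 = 0 would make u singular. *)
have : GLval (u^-1 * u)%g 1 0 = 0 by rewrite mulVg GL2_1 mxE.
rewrite GL2_M mulmx2E u0 mulr0 addr0 => /eqP.
rewrite mulf_eq0 => /orP[//|/eqP u00].
by have := GL2_det u; rewrite det_mx2 u0 u00 mul0r mulr0 subrr eqxx.
Qed.

Lemma iwahoriM g h : iwahori g -> iwahori h -> iwahori (g * h)%g.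
Proof.
move=> [u ub gu] [w wb hw].
by exists (u * w)%g; [exact: borel_fM | exact: coset_mul].
Qed.

Lemma iwahoriV g : iwahori g -> iwahori g^-1%g.
Proof. by move=> [u ub gu]; exists u^-1%g; [exact: borel_fV | exact: coset_inv]. Qed.

Lemma iwahori_mx2 (a b c d : F) : vge 0 a -> vge 0 b -> vge 1 c -> vge 0 d ->
  res a != 0 -> res d != 0 -> exists2 g, gl2_mx g = mx2 a b c d & iwahori g.
Proof.
move=> a0 b0 c1 d0 ra rd; have c0 := val_ge01 c1.
have rc : res c = 0 by apply/eqP; rewrite res_eq0.
have [||g [u [gE uE gu]]] := @coset_of_mx (mx2 a b c d).
- exact: integral_mx2.
- by rewrite mx2_map mx2_det rc mulr0 subr0 mulf_neq0.
exists g => //; exists u => //.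
by apply/borel_fE; rewrite uE mx2_map mxE.
Qed.

Lemma maxK_mx2 (a b c d : F) : vge 0 a -> vge 0 b -> vge 0 c -> vge 0 d ->
  res (a * d - b * c) != 0 -> exists2 g, gl2_mx g = mx2 a b c d & maxK g.
Proof.
move=> a0 b0 c0 d0 r; have iM := integral_mx2 a0 b0 c0 d0.
have [||g [u [gE uE [gu _]]]] := @coset_of_mx (mx2 a b c d) => //.
  by rewrite -res_det // mx2_det.
by exists g.
Qed.

(* The image in G_f of the intersection of K and x^-1 I x contains w^-1 B w. *)
Definition stab_contains_borel x := exists w, forall b, borel_f b ->
  exists2 g, coset_K1 (w^-1 * b * w)%g g & iwahori (x * g * x^-1)%g.

(** If h lifts u, conjugation by h carries the lifts for i x h to lifts for x, with w replaced by w
    u^-1; conjugation by i preserves I. *)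
Lemma stab_transfer x i h : iwahori i -> maxK h ->
  stab_contains_borel (i * x * h)%g -> stab_contains_borel x.
Proof.
move=> iI /maxK_coset[u hu] [w Pw]; exists (w * u^-1)%g => b /Pw[g gw gI].
exists (h * g * h^-1)%g.
  have -> : ((w * u^-1)^-1 * b * (w * u^-1) = u * (w^-1 * b * w) * u^-1)%g.
    by rewrite invMg invgK !mulgA.
  by apply: coset_mul; [exact: coset_mul | exact: coset_inv].
have -> : (x * (h * g * h^-1) * x^-1 =
           i^-1 * (i * x * h * g * (i * x * h)^-1) * i)%g.
  by rewrite !invMg !mulgA mulVg mul1g mulgKV.
by apply: iwahoriM => //; apply: iwahoriM => //; exact: iwahoriV.
Qed.

(** The second alternative is strict, so that the quotient may serve as a lower left entry in I. *)
Lemma val_ge_total (a b : F) : a != 0 -> b != 0 ->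
  vge 0 (a / b) \/ vge 1 (b / a).
Proof.
move=> a0 b0.
rewrite !val_geE ?mulf_neq0 ?invr_eq0 // !valM ?invr_eq0 // !valV //.
by rewrite subr_ge0 lerBrDl addrC lez1D; case: (leP (v b) (v a)); [left|right].
Qed.

(** Conjugation by x multiplies the upper right entry by a/d and the lower left one by d/a. If a/d
    is integral, upper triangular lifts of B stay in I and w = 1 works. Otherwise d/a lies in the
    maximal ideal, and lower triangular lifts of the opposite Borel are sent into I. *)
Lemma stab_diag x (a d : F) : gl2_mx x = mx2 a 0 0 d -> stab_contains_borel x.
Proof.
move=> xE; have /andP[a0 d0] : (a != 0) && (d != 0).
  by have := gl2_det x; rewrite xE mx2_det mulr0 subr0 mulf_eq0 negb_or.
have [ad|da] := val_ge_total a0 d0.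
- exists 1%g => b /borel_fE b10; rewrite invg1 mul1g mulg1.
  have [b00 b00i b00r] := exists_residue F (GLval b 0 0).
  have [b01 b01i b01r] := exists_residue F (GLval b 0 1).
  have [b11 b11i b11r] := exists_residue F (GLval b 1 1).
  have := GL2_det b; rewrite det_mx2 b10 mulr0 subr0 mulf_eq0 negb_or.
  case/andP=> nb00 nb11.
  have [||g [u [gE uE gu]]] := @coset_of_mx (mx2 b00 b01 0 b11).
  + exact: (integral_mx2 _ _ (val_ge0 _ _)).
  + by rewrite mx2_map mx2_det b00r b11r res0 mulr0 subr0 mulf_neq0.
  exists g.
    rewrite -(_ : u = b) //; apply: val_inj.
    by rewrite /= uE mx2_map [RHS]mx2_eta b10 b00r b01r b11r res0.
  have [||||||h hE hI] := @iwahori_mx2 b00 (a / d * b01) 0 b11;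
    rewrite ?b00r ?b11r ?val_ge0 //; first exact: val_geMl.
  rewrite -(_ : h = (x * g * x^-1)%g) //; apply: (mulIg x); rewrite mulgKV.
  apply: gl2_inj; rewrite !gl2M xE gE hE !mx2_mul.
  by congr mx2; field.
(* Here w is the Weyl element, which exchanges B with the opposite Borel. *)
have [|w wE] := @exists_GLval k (mx2 0 1 1 0).
  by rewrite mx2_det mul0r mul1r sub0r oppr_eq0 oner_eq0.
exists w => b /borel_fE b10.
have [b00 b00i b00r] := exists_residue F (GLval b 0 0).
have [b01 b01i b01r] := exists_residue F (GLval b 0 1).
have [b11 b11i b11r] := exists_residue F (GLval b 1 1).
have := GL2_det b; rewrite det_mx2 b10 mulr0 subr0 mulf_eq0 negb_or.
case/andP=> nb00 nb11.
have [||g [u [gE uE gu]]] := @coset_of_mx (mx2 b11 0 b01 b00).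
- exact: (integral_mx2 _ (val_ge0 _ _)).
- by rewrite mx2_map mx2_det b00r b11r res0 mul0r subr0 mulf_neq0.
exists g.
  rewrite -(_ : u = (w^-1 * b * w)%g) //; apply: (mulgI w).
  rewrite -!mulgA mulKVg; apply: GLval_inj; rewrite !GL2_M uE wE.
  rewrite [GLval b]mx2_eta b10 mx2_map b00r b01r b11r res0 !mx2_mul.
  by congr mx2; ring.
have [||||||h hE hI] := @iwahori_mx2 b11 0 (d / a * b01) b00;
  rewrite ?b00r ?b11r ?val_ge0 //; first exact: val_geMr.
rewrite -(_ : h = (x * g * x^-1)%g) //; apply: (mulIg x); rewrite mulgKV.
apply: gl2_inj; rewrite !gl2M xE gE hE !mx2_mul.
by congr mx2; field.
Qed.

(** If b/a is integral a column operation clears b; if b/d is integral a row operation does.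
    Otherwise a/b and d/b both lie in the maximal ideal and b becomes the pivot. *)
Lemma stab_upper x (a b d : F) :
  gl2_mx x = mx2 a b 0 d -> stab_contains_borel x.
Proof.
move=> xE; have /andP[a0 d0] : (a != 0) && (d != 0).
  by have := gl2_det x; rewrite xE mx2_det mulr0 subr0 mulf_eq0 negb_or.
have [b0|b0] := eqVneq b 0; first by apply: stab_diag; rewrite xE b0.
have z0 := val_ge0 F; have z1 := @val_ge1 k F.
have r1 : res 1 != 0 by rewrite res1 oner_eq0.
have [ba|ab] := val_ge_total b0 a0.
  have [||||||i iE iI] := @iwahori_mx2 1 0 0 1 => //.
  have [|||||h hE hK] := @maxK_mx2 1 (- (b / a)) 0 1 => //.
  - by rewrite val_geN.
  - by rewrite mulr1 mulr0 subr0.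
  apply: (stab_transfer iI hK); apply: (@stab_diag _ a d).
  rewrite !gl2M iE xE hE !mx2_mul; by congr mx2; field.
have [bd|db] := val_ge_total b0 d0.
  have [||||||i iE iI] := @iwahori_mx2 1 (- (b / d)) 0 1 => //.
    by rewrite val_geN.
  have [|||||h hE hK] := @maxK_mx2 1 0 0 1 => //.
    by rewrite mulr1 mulr0 subr0.
  apply: (stab_transfer iI hK); apply: (@stab_diag _ a d).
  rewrite !gl2M iE xE hE !mx2_mul; by congr mx2; field.
(* The row operation clears d with b as pivot; h then swaps the columns and clears a. *)
have [||||||i iE iI] := @iwahori_mx2 1 0 (- (d / b)) 1 => //.
  by rewrite val_geN.
have [|||||h hE hK] := @maxK_mx2 0 1 1 (- (a / b)) => //.
- by rewrite val_geN val_ge01.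
- by rewrite mul0r mulr1 sub0r resN // oppr_eq0.
apply: (stab_transfer iI hK); apply: (@stab_diag _ b (- (a * d / b))).
rewrite !gl2M iE xE hE !mx2_mul; by congr mx2; field.
Qed.

(** Column operations over the integers suffice to clear the lower left entry c, so the factor i in
    I is the identity here. The pivot of the bottom row is its entry of smaller valuation. *)
Lemma stab_contains_borelT x : stab_contains_borel x.
Proof.
have [a [b [c [d xE]]]] : exists a b' c d : F, gl2_mx x = mx2 a b' c d.
  by do 4 eexists; exact: mx2_eta.
have [c0|c0] := eqVneq c 0.
  by apply: (@stab_upper _ a b d); rewrite xE c0.
have z0 := val_ge0 F; have z1 := @val_ge1 k F.
have r1 : res 1 != 0 by rewrite res1 oner_eq0.
have [||||||i iE iI] := @iwahori_mx2 1 0 0 1 => //.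
have [dc|[d0 cd]] : vge 0 (d / c) \/ d != 0 /\ vge 0 (c / d).
- have [->|d0] := eqVneq d 0; first by left; rewrite mul0r.
  by have [|/val_ge01] := val_ge_total d0 c0; [left|right].
- have [|||||h hE hK] := @maxK_mx2 (- (d / c)) 1 1 0 => //.
  + by rewrite val_geN.
  + by rewrite mulr0 mulr1 sub0r resN // oppr_eq0.
  apply: (stab_transfer iI hK).
  apply: (@stab_upper _ (b - a * d / c) a c).
  rewrite !gl2M iE xE hE !mx2_mul; by congr mx2; field.
have [|||||h hE hK] := @maxK_mx2 1 0 (- (c / d)) 1 => //.
- by rewrite val_geN.
- by rewrite mulr1 mul0r subr0.
apply: (stab_transfer iI hK).
apply: (@stab_upper _ (a - b * c / d) b d).
rewrite !gl2M iE xE hE !mx2_mul; by congr mx2; field.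
Qed.

End Reduction.

(** * Congruence subgroups *)

Section Congruence.
Variables (k : finFieldType) (F : nonarchLocalFieldType k).
Local Notation v := (@valuation k F).
Local Notation vge := (val_ge (@valuation k F)).
Local Notation res := (@residue k F).
Local Notation G := (GL2 F).
Implicit Types (g h : G) (A B M : 'M[F]_2).

Definition mx_val_ge (n : int) A := forall i j, vge n (A i j).

Lemma mx_val_geM m n A B :
  mx_val_ge m A -> mx_val_ge n B -> mx_val_ge (m + n) (A *m B).
Proof.
by move=> mA nB i j; rewrite mulmx2E; apply: val_geD; exact: val_geM.
Qed.

Lemma mx_val_geW m n A : m <= n -> mx_val_ge n A -> mx_val_ge m A.
Proof. by move=> mn nA i j; exact: val_geW mn _. Qed.

Lemma mx_val_geB n A B :
  mx_val_ge n A -> mx_val_ge n B -> mx_val_ge n (A - B).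
Proof. by move=> nA nB i j; rewrite !mxE; exact: val_geB. Qed.

Lemma mx_val_geD n A B :
  mx_val_ge n A -> mx_val_ge n B -> mx_val_ge n (A + B).
Proof. by move=> nA nB i j; rewrite !mxE; exact: val_geD. Qed.

Lemma exists_mx_val_ge A : exists m : nat, mx_val_ge (- m%:Z) A.
Proof.
pose m := (\max_i \max_j `|v (A i j)|)%N; exists m => i j.
have [->|A0] := eqVneq (A i j) 0; first exact: val_ge0.
rewrite val_geE // lerNl (le_trans (ler_norm _)) // normrN -abszE lez_nat.
apply: leq_trans (leq_bigmax i); exact: (@leq_bigmax _ (fun j => `|v (A i j)|%N)).
Qed.

(* The kernel of reduction modulo the (n+1)-st power of the maximal ideal. *)
Definition congr_subgroup (n : nat) : set G :=
  [set g | mx_val_ge n.+1%:Z (gl2_mx g - 1%:M)].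

Lemma congr_subgroupE n g :
  congr_subgroup n g = mx_val_ge n.+1%:Z (gl2_mx g - 1%:M).
Proof. by []. Qed.

Lemma integral_congr M : mx_val_ge 1 (M - 1%:M) ->
  integral M /\ map_mx res M = 1%:M.
Proof.
move=> M1; have iM : integral M.
  have : mx_val_ge 0 (M - 1%:M + 1%:M).
    by apply: mx_val_geD; [exact: mx_val_geW M1 | exact: integral1].
  by rewrite subrK.
split=> //; rewrite -(res_mx1 F); apply/matrixP => i j; rewrite !mxE.
apply/eqP; rewrite res_eq //; last by have := @integral1 k F i j; rewrite !mxE.
by have := M1 i j; rewrite !mxE.
Qed.

(** A matrix congruent to 1 modulo the maximal ideal reduces to 1, hence is invertible with integral
    inverse. *)
Lemma coset_congr M : mx_val_ge 1 (M - 1%:M) ->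
  exists2 g : G, gl2_mx g = M & K1 g.
Proof.
move=> /integral_congr[iM rM].
have [|g [u [gM uE gu]]] := coset_of_mx iM; first by rewrite rM det1 oner_eq0.
by exists g => //; split; [case: gu | rewrite gM rM].
Qed.

Lemma congr_subgroup0 : congr_subgroup 0 = @K1 k F.
Proof.
apply/seteqP; split => g.
  by move=> /coset_congr[h /gl2_inj ->].
move=> [[ig _] g1] i j; rewrite !mxE -res_eq //.
  by move/matrixP/(_ i j): g1; rewrite GL2_1 -(res_mx1 F) !mxE => ->.
by have := @integral1 k F i j; rewrite !mxE.
Qed.

Lemma congr_subgroupW m n :
  (m <= n)%N -> congr_subgroup n `<=` congr_subgroup m.
Proof. by move=> mn g; apply: mx_val_geW; rewrite lez_nat. Qed.

Lemma congr_subgroup_K1 n : congr_subgroup n `<=` @K1 k F.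
Proof. by rewrite -congr_subgroup0; exact: congr_subgroupW. Qed.

Lemma congr_subgroupM n g h :
  congr_subgroup n g -> congr_subgroup n h -> congr_subgroup n (g * h)%g.
Proof.
move=> gn hn; have [[ih _] _] := congr_subgroup_K1 hn.
rewrite congr_subgroupE gl2M.
have -> : gl2_mx g *m gl2_mx h - 1%:M =
          (gl2_mx g - 1%:M) *m gl2_mx h + (gl2_mx h - 1%:M).
  by rewrite mulmxBl mul1mx addrA subrK.
apply: mx_val_geD => //; rewrite -[n.+1%:Z]addr0; exact: mx_val_geM.
Qed.

Lemma congr_subgroupV n g : congr_subgroup n g -> congr_subgroup n g^-1%g.
Proof.
move=> gn; have [[_ iVg] _] := congr_subgroup_K1 gn.
rewrite congr_subgroupE.
have -> : gl2_mx g^-1%g - 1%:M = 0 - gl2_mx g^-1%g *m (gl2_mx g - 1%:M).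
  by rewrite mulmxBr -gl2M mulVg mulmx1 sub0r opprB.
apply: mx_val_geB => [i j|]; first by rewrite mxE val_ge0.
rewrite -[n.+1%:Z]add0r; exact: mx_val_geM.
Qed.

(** The topology comes from entries in M_2(F), and the comparison rests on gu - g = g(u - 1) and
    g^-1 h - 1 = g^-1 (h - g). The entries of g and g^-1 have bounded denominators, which costs m
    levels of precision. *)
Lemma nbhs_GL2 g (A : set G) :
  nbhs g A <-> exists n, forall u, congr_subgroup n u -> A (g * u)%g.
Proof.
split.
  rewrite nbhsE => -[B [[C oC <-] Cg] sBA].
  have [P nP sPC] : nbhs (gl2_mx g) C by exact: open_nbhs_nbhs.
  have /choice[N NP] : forall ij : 'I_2 * 'I_2, exists n : nat,
      forall z : F, vge n%:Z (z - gl2_mx g ij.1 ij.2) -> P ij.1 ij.2 z.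
    move=> [i j] /=; have := nP i j; rewrite nbhs_valuation => -[z sz].
    exists `|z|%N => t zt; apply: sz; apply: val_geW zt.
    by rewrite abszE ler_norm.
  have [m gm] := exists_mx_val_ge (gl2_mx g).
  pose n := (\max_ij N ij)%N.
  exists (n + m)%N => u un; apply: sBA; apply: sPC => i j.
  apply: (NP (i, j)) => /=.
  have : mx_val_ge n%:Z (gl2_mx g *m (gl2_mx u - 1%:M)).
    apply: mx_val_geW (mx_val_geM gm un).
    by rewrite -addSn PoszD addrC addrK lez_nat.
  rewrite mulmxBr mulmx1 => /(_ i j); rewrite !mxE; apply: val_geW.
  by rewrite lez_nat; exact: leq_bigmax.
move=> [n nA]; have [m gm] := exists_mx_val_ge (gl2_mx g^-1%g).
have : nbhs (gl2_mx g) [set M | mx_val_ge (n.+1 + m)%:Z (M - gl2_mx g)].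
  exists (fun i j => [set z | vge (n.+1 + m)%:Z (z - gl2_mx g i j)]) => [i j|M].
    by rewrite nbhs_valuation; exists (n.+1 + m)%:Z.
  by move=> H i j; rewrite !mxE; exact: H.
move=> /(@initial_continuous _ _ (@gl2_mx F) g) ng.
have {ng} : nbhs g [set h | mx_val_ge (n.+1 + m)%:Z (gl2_mx h - gl2_mx g)].
  exact: ng.
apply: filterS => h /= hg.
rewrite -(mulKVg g h); apply: nA; rewrite congr_subgroupE.
have -> : gl2_mx (g^-1 * h)%g - 1%:M =
          gl2_mx g^-1%g *m (gl2_mx h - gl2_mx g).
  by rewrite mulmxBr -!gl2M mulVg.
apply: mx_val_geW (mx_val_geM gm hg).
by rewrite PoszD addrC addrK.
Qed.

(** Compactness of the integers of F, digit by digit: the residue field is finite, so the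
    ultrafilter selects one class modulo each power of the maximal ideal. Representatives of these
    classes form a Cauchy sequence, and completeness supplies x. *)
Lemma ultra_limit (T : Type) (U : set_system T) (f : T -> F) :
  UltraFilter U -> U [set t | vge 0 (f t)] ->
  exists x : F, forall n : nat, U [set t | vge n%:Z (f t - x)].
Proof.
move=> UU U0; have PU := @ultra_proper _ _ UU.
have [pi pi0 pi1] := @valuation_uniformizer k F.
have vpi n : v (pi ^+ n) = n%:Z.
  elim: n => [|n IHn]; first by rewrite expr0 val1.
  by rewrite exprS valM ?expf_neq0 // IHn pi1 -PoszD.
have /choice[x xU] : forall n : nat, exists x : F, U [set t | vge n%:Z (f t - x)].
  elim=> [|n [x xU]]; first by exists 0; under eq_fun do rewrite subr0.
  pose e := pi ^+ n; have e0 : e != 0 by rewrite expf_neq0.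
  have eE m t : vge (n%:Z + m) t = vge m (t / e).
    by rewrite -val_ge_quot // vpi.
  apply: contrapT => nx.
  (* If no residue class of the next digit belonged to U, the finite intersection of their
     complements would, yet it is empty. *)
  have : U [set t | forall a : k, ~ res ((f t - x) / e) = a].
    apply: filter_forall => a; have [z z0 za] := exists_residue F a.
    have [H|//] := in_ultra_setVsetC [set t | res ((f t - x) / e) = a] UU.
    (* The next approximation adds the digit z at the place of [pi ^+ n]. *)
    case: nx; exists (x + z * e).
    apply: filterS (filterI xU H) => t /= [t0 ta].
    rewrite -addn1 PoszD eE opprD addrA mulrBl mulfK //.
    by rewrite -res_eq ?ta ?za // -eE addr0.
  by move=> /filter_ex[t /(_ (res ((f t - x) / e)))].
have xx i j m : (m <= i)%N -> (m <= j)%N -> vge m%:Z (x i - x j).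
  move=> mi mj; have [t [/= ti tj]] := filter_ex (filterI (xU i) (xU j)).
  have -> : x i - x j = (f t - x j) - (f t - x i).
    by rewrite opprB [RHS]addrC addrA subrK.
  by apply: val_geB; [apply: val_geW tj | apply: val_geW ti]; rewrite lez_nat.
have [|z xz] := @valuation_complete k F x.
  move=> n; exists `|n|%N => i j ni nj; apply: val_geW (xx _ _ _ ni nj).
  by rewrite abszE ler_norm.
exists z => n.
have : nbhs z [set t | vge n%:Z (t - z)] by rewrite nbhs_valuation; exists n%:Z.
(* The index must be at least N to be close to z, and at least n to approximate f along U. *)
move=> /xz[N _ HN]; have := HN (maxn N n) (leq_maxl _ _) => /= xNz.
apply: filterS (xU (maxn N n)) => t /= tx.
rewrite -[f t](subrK (x (maxn N n))) -addrA; apply: val_geD => //.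
by apply: val_geW tx; rewrite lez_nat leq_maxr.
Qed.

(** An ultrafilter on K^1 has an entrywise limit M. Some g in K^1 agrees with M modulo the maximal
    ideal, so M is again in K^1; since its inverse is integral, entrywise convergence gives
    convergence in G. *)
Lemma compact_K1 : compact (@K1 k F).
Proof.
rewrite compact_ultra => U UU UK; have PU := @ultra_proper _ _ UU.
have /choice[x xU] : forall ij : 'I_2 * 'I_2, exists x : F, forall n : nat,
    U [set g | vge n%:Z (gl2_mx g ij.1 ij.2 - x)].
  move=> [i j]; apply: ultra_limit; apply: filterS UK => g [[ig _] _].
  exact: ig.
pose M : 'M[F]_2 := \matrix_(i, j) x (i, j).
have MU n : U [set g | mx_val_ge n%:Z (gl2_mx g - M)].
  have : U [set g | forall ij, vge n%:Z (gl2_mx g ij.1 ij.2 - x ij)].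
    by apply: filter_forall => ij; exact: xU.
  apply: filterS => g H i j.
  by rewrite !mxE; exact: (H (i, j)).
have [|g0 gM gK] := @coset_congr M.
  have [g [/= gK gM]] := filter_ex (filterI UK (MU 1%N)).
  have -> : M - 1%:M = (gl2_mx g - 1%:M) - (gl2_mx g - M).
    by rewrite opprB [RHS]addrC addrA subrK.
  by apply: mx_val_geB => //; move: gK; rewrite -congr_subgroup0.
exists g0; split=> // A /nbhs_GL2[n nA]; apply: filterS (MU n.+1) => h /= hM.
rewrite -(mulKVg g0 h); apply: nA; rewrite congr_subgroupE.
have -> : gl2_mx (g0^-1 * h)%g - 1%:M = gl2_mx g0^-1%g *m (gl2_mx h - M).
  by rewrite -gM mulmxBr -!gl2M mulVg.
rewrite -[n.+1%:Z]add0r; apply: mx_val_geM => //.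
by case: gK => -[].
Qed.

End Congruence.

(** * Hecke algebra and annihilators *)

(** If Q failed on C, the sets A with Q (C \ A) would form a proper filter containing C. At a
    cluster point in C, a neighbourhood satisfying Q has its complement in this filter, a
    contradiction. *)
Lemma compact_induction (T : topologicalType) (C : set T) (Q : set T -> Prop) :
  compact C -> Q set0 -> (forall A B, A `<=` B -> Q B -> Q A) ->
  (forall A B, Q A -> Q B -> Q (A `|` B)) ->
  (forall x, C x -> exists2 V, nbhs x V & Q V) -> Q C.
Proof.
move=> cC Q0 QS QU Qloc; apply: contrapT => nQC.
pose Fl : set_system T := [set A | Q (C `\` A)].
have FF : ProperFilter Fl.
  apply: Build_ProperFilter_ex; last split.
  - move=> A QA; apply: contrapT => nA; apply: nQC; apply: QS QA => x Cx.
    by split=> // Ax; apply: nA; exists x.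
  - by rewrite /Fl /= setDT.
  - by move=> A B QA QB; apply: QS (QU _ _ QA QB); rewrite setDIr.
  - by move=> A B AB; apply: QS => x [Cx nB]; split=> // /AB.
have [|x [Cx clx]] := cC Fl FF; first by rewrite /Fl /= setDv.
have [V Vx QV] := Qloc x Cx.
have [|y [nVy Vy]] := clx (~` V) V _ Vx; last exact: nVy.
by apply: QS QV => y [_ /contrapT].
Qed.

Lemma indic_iff (R : pzRingType) (T T' : Type) (A : set T) (B : set T') x y :
  (A x <-> B y) -> \1_A x = \1_B y :> R.
Proof.
move=> AB; rewrite !indicE; congr (nat_of_bool _)%:R.
by apply/idP/idP; rewrite !inE => /AB.
Qed.

(** * Left translates of K^1 *)

Section Translation.
Variables (k : finFieldType) (F : nonarchLocalFieldType k).
Local Notation G := (GL2 F).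
Implicit Types (g h x y : G).

Lemma continuous_mulg g : continuous (fun x : G => (g * x)%g).
Proof.
move=> x A /nbhs_GL2[n nA]; apply/nbhs_GL2; exists n => u /nA.
by rewrite -mulgA.
Qed.

Definition lcoset_K1 g : set G := [set x | K1 (g^-1 * x)%g].

Lemma compact_lcoset_K1 g : compact (lcoset_K1 g).
Proof.
have -> : lcoset_K1 g = (fun x => (g * x)%g) @` K1 (F := F).
  apply/seteqP; split=> [x Kx|_ [x Kx <-]]; last by rewrite /lcoset_K1 /= mulKg.
  by exists (g^-1 * x)%g => //; rewrite mulKVg.
apply: continuous_compact; last exact: compact_K1.
by apply: continuous_subspaceT; exact: continuous_mulg.
Qed.

(** For x in the closure, the neighbourhood x K^1 meets g K^1, so the two cosets coincide. *)
Lemma closed_lcoset_K1 g : closed (lcoset_K1 g).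
Proof.
move=> x clx.
have [|y [gy xy]] := clx [set y | congr_subgroup 0 (x^-1 * y)%g].
  by apply/nbhs_GL2; exists 0%N => u; rewrite /= mulKg.
move: xy; rewrite /= congr_subgroup0 => xy.
apply: (proj1 (coset_rK1 1%g (g^-1 * x)%g xy)).
by rewrite -mulgA mulKVg; exact: gy.
Qed.

End Translation.

(** * Local constancy and supports in the Hecke algebra *)

Section HeckeAlgebra.
Variables (k : finFieldType) (F : nonarchLocalFieldType k) (R : closedFieldType).
Local Notation G := (GL2 F).
Local Notation Gf := {'GL_2[k]}.
Implicit Types (g x y : G) (f h : G -> R) (u w b : Gf).

Definition locally_constant f := forall x, \forall y \near x, f y = f x.

Definition congr_invariant n f :=
  forall x y, congr_subgroup n y -> f (x * y)%g = f x.

Lemma congr_invariant_lc n f : congr_invariant n f -> locally_constant f.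
Proof. by move=> fn x; apply/nbhs_GL2; exists n => y; exact: fn. Qed.

Lemma locally_constantM f h : locally_constant f -> locally_constant h ->
  locally_constant (fun x => f x * h x).
Proof.
by move=> lf lh x; apply: filterS2 (lf x) (lh x) => y /= -> ->.
Qed.

(** Closedness of C keeps the closure of the support inside C. *)
Lemma hecke_support f (C : set G) : locally_constant f -> compact C ->
  closed C -> (forall x, f x != 0 -> C x) -> hecke f.
Proof.
move=> lf cC clC fC; split=> //.
apply: subclosed_compact cC _; first exact: closed_closure.
by move/closure_id: clC => ->; exact: closure_subset.
Qed.

Lemma hecke_lcoset n g f : congr_invariant n f ->
  (forall x, f x != 0 -> lcoset_K1 g x) -> hecke f.
Proof.
move=> fn fg; apply: hecke_support fg.
- exact: congr_invariant_lc fn.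
- exact: compact_lcoset_K1.
- exact: closed_lcoset_K1.
Qed.

Lemma hecke_lin (a : R) f h : hecke f -> hecke h ->
  hecke (fun x => a * f x + h x).
Proof.
move=> [lf cf] [lh ch].
apply: (@hecke_support _ (closure [set x | f x != 0] `|`
                          closure [set x | h x != 0])).
- by move=> x; apply: filterS2 (lf x) (lh x) => y /= -> ->.
- exact: compactU.
- by apply: closedU; exact: closed_closure.
- move=> x nz; have [fx|fx] := eqVneq (f x) 0.
    by right; apply: subset_closure => /=; move: nz; rewrite fx mulr0 add0r.
  by left; exact: subset_closure.
Qed.

Lemma hecke_mul f h : hecke f -> locally_constant h ->
  hecke (fun x => f x * h x).
Proof.
move=> [lf cf] lh.
apply: (@hecke_support _ (closure [set x | f x != 0])) => //.
- exact: locally_constantM.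
- exact: closed_closure.
- move=> x; rewrite mulf_eq0 negb_or => /andP[fx _].
  exact: subset_closure.
Qed.

Lemma hecke0 : hecke (fun _ : G => 0 : R).
Proof.
apply: (@hecke_support _ set0); [|exact: compact0|exact: closed0|].
  by move=> x; exact: filterE.
by move=> x; rewrite eqxx.
Qed.

(** Compactness turns the local levels of invariance into a common one on the support. *)
Lemma hecke_uniform h : hecke h -> exists n, congr_invariant n h.
Proof.
move=> [lh ch]; set C := closure _ in ch.
pose Q (A : set G) := exists n, forall x y, A x -> congr_subgroup n y ->
  h (x * y)%g = h x.
have [|A B AB [n nB]|A B [m mA] [n nB]|x _|n nC] := @compact_induction _ C Q ch.
- by exists 0%N.
- by exists n => x y /AB; exact: nB.
- exists (maxn m n) => x y [Ax|Bx] xy.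
    by apply: mA => //; apply: congr_subgroupW xy; rewrite leq_maxl.
  by apply: nB => //; apply: congr_subgroupW xy; rewrite leq_maxr.
- have /nbhs_GL2[n nh] := lh x.
  exists [set y | congr_subgroup n (x^-1 * y)%g].
    by apply/nbhs_GL2; exists n => y; rewrite /= mulKg.
  exists n => y z /= xy zn; rewrite -(mulKVg x y) -mulgA !nh //.
  exact: congr_subgroupM.
(* If h x = 0 but h (x y) is nonzero, invariance at x y under y^-1 gives a contradiction. *)
exists n => x y yn; have [hx|hx] := eqVneq (h x) 0; last first.
  by apply: nC => //; exact: subset_closure.
apply: contrapT => /eqP; rewrite hx => hxy.
have Cxy : C (x * y)%g by exact: subset_closure.
have := nC _ _ Cxy (congr_subgroupV yn).
by rewrite mulgK hx => /esym/eqP; rewrite (negPf hxy).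
Qed.

(** The list s drives the induction that removes one coset at a time from the support of h. *)
Lemma hecke_finite_support n h : hecke h -> exists s : seq G,
  forall x, h x != 0 -> exists2 g, g \in s & congr_subgroup n (g^-1 * x)%g.
Proof.
move=> [_ ch]; set C := closure _ in ch.
pose Q (A : set G) := exists s : seq G, forall x, A x ->
  exists2 g, g \in s & congr_subgroup n (g^-1 * x)%g.
have [|A B AB [s sB]|A B [s sA] [t tB]|x _|s sC] := @compact_induction _ C Q ch.
- by exists [::].
- by exists s => x /AB; exact: sB.
- exists (s ++ t) => x [/sA|/tB] [g gs gx]; exists g => //;
    by rewrite mem_cat gs ?orbT.
- exists [set y | congr_subgroup n (x^-1 * y)%g].
    by apply/nbhs_GL2; exists n => y; rewrite /= mulKg.
  by exists [:: x] => y xy; exists x; rewrite ?inE.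
by exists s => x hx; apply: sC; exact: subset_closure.
Qed.

Lemma hecke_of_f_lK1 (a : {ffun Gf -> R}) x y : K1 x ->
  hecke_of_f a (x * y)%g = hecke_of_f a y.
Proof.
move=> Kx; apply: eq_bigr => u _; congr (_ * _).
by apply: indic_iff; exact: coset_lK1.
Qed.

Lemma ind_iwahori_congr f : ind_iwahori f -> exists n, congr_invariant n f.
Proof.
move=> [_ [U [oU [U1 _] fU]] _].
have /nbhs_GL2[n nU] : nbhs (1%g : G) U by exact: open_nbhs_nbhs.
by exists n => x y /nU; rewrite mul1g; exact: fU.
Qed.

Lemma ind_iwahori_lc f x : ind_iwahori f -> locally_constant (fun y => f (x * y)%g).
Proof.
move=> /ind_iwahori_congr[n fn]; apply: (@congr_invariant_lc n) => y z zn.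
by rewrite mulgA; exact: fn.
Qed.

(** This translated fibre is the single coset g z K^1, where z lifts u. *)
Lemma hecke_coset g u : hecke (fun x => \1_(coset_K1 u) (g^-1 * x)%g : R).
Proof.
have [z zu] := coset_lift F u.
apply: (@hecke_lcoset 0 (g * z)%g) => [x y|x].
  rewrite congr_subgroup0 => Ky; apply: indic_iff.
  by rewrite mulgA; exact: coset_rK1.
rewrite indicE; case: (boolP (_ \in _)) => [|_]; last by rewrite eqxx.
rewrite inE => ux _; rewrite /lcoset_K1 /= invMg -mulgA.
by apply/(coset_shift _ zu); rewrite mulKVg.
Qed.

(** * Integration and the annihilator of ind_I^G 1 *)

Section Measure.
Variables (mu : (G -> R) -> R) (hmu : haar_measure mu).

Lemma haar0 : mu (fun=> 0) = 0.
Proof.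
apply: (addrI (mu (fun=> 0))); rewrite addr0 -{1}[mu _]mul1r.
rewrite -(haar_linear hmu _ hecke0 hecke0); congr mu.
by apply/funext => x; rewrite mulr0 addr0.
Qed.

(** Linearity of [mu] is available only on [hecke], so membership and the value of the integral are
    carried through the induction together. *)
Lemma hecke_sum (I : Type) (s : seq I) (c : I -> R) (f : I -> G -> R) :
  (forall i, hecke (f i)) ->
  hecke (fun x => \sum_(i <- s) c i * f i x) /\
  mu (fun x => \sum_(i <- s) c i * f i x) = \sum_(i <- s) c i * mu (f i).
Proof.
move=> hf; elim: s => [|i s [IHh IHm]].
  under eq_fun do rewrite big_nil.
  by rewrite big_nil; split; [exact: hecke0 | exact: haar0].
under eq_fun do rewrite big_cons.
rewrite big_cons -IHm; split; first exact: hecke_lin.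
exact: haar_linear.
Qed.

Lemma hecke_of_f_hecke g (a : {ffun Gf -> R}) :
  hecke (fun x => hecke_of_f a (g^-1 * x)%g).
Proof.
by have [] := @hecke_sum _ (index_enum _) a _ (hecke_coset g).
Qed.

Lemma ann_ind0 : ann_ind mu (fun=> 0).
Proof.
split=> [|f _ x]; first exact: hecke0.
by rewrite /hecke_act; under eq_fun do rewrite mul0r; exact: haar0.
Qed.

Lemma ann_ind_lin (a : R) f h : ann_ind mu f -> ann_ind mu h ->
  ann_ind mu (fun x => a * f x + h x).
Proof.
move=> [hf af] [hh ah]; split=> [|phi phiI x]; first exact: hecke_lin.
rewrite /hecke_act; under eq_fun do rewrite mulrDl -mulrA.
have lc := ind_iwahori_lc x phiI.
rewrite (haar_linear hmu a (hecke_mul hf lc) (hecke_mul hh lc)).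
have -> : mu _ = 0 := af _ phiI x.
have -> : mu _ = 0 := ah _ phiI x.
by rewrite mulr0 addr0.
Qed.

Lemma ann_ind_sum (I : Type) (s : seq I) (f : I -> G -> R) :
  (forall i, ann_ind mu (f i)) -> ann_ind mu (fun x => \sum_(i <- s) f i x).
Proof.
move=> af; elim: s => [|i s IHs].
  by under eq_fun do rewrite big_nil; exact: ann_ind0.
by under eq_fun do rewrite big_cons -[f i _]mul1r; exact: ann_ind_lin.
Qed.

(** The sum is the action of a, evaluated at w, on the function v |-> phi (x z(w^-1 v)). That
    function is left B-invariant because x^-1 I x contains lifts of w^-1 B w. *)
Lemma ann_ind_f_sum (a : {ffun Gf -> R}) (phi : G -> R) (z : Gf -> G) x :
  ann_ind_f k R a ->
  (forall i y, iwahori i -> phi (i * y)%g = phi y) ->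
  (forall y i, K1 i -> phi (y * i)%g = phi y) ->
  (forall u, coset_K1 u (z u)) ->
  \sum_u a u * phi (x * z u)%g = 0.
Proof.
move=> aI phiI phiK zu; have [w Pw] := stab_contains_borelT x.
rewrite -[RHS](aI (fun u => phi (x * z (w^-1 * u)%g)%g) _ w); last first.
  move=> b u /Pw[g gb gI].
  have gz := coset_mul gb (zu (w^-1 * u)%g).
  (* Both g z(w^-1 u) and z(w^-1 b u) lift w^-1 b u, so they differ by K^1 on the right; then x g =
     (x g x^-1) x and x g x^-1 lies in I. *)
  have : K1 ((g * z (w^-1 * u))^-1 * z (w^-1 * (b * u)))%g.
    apply/(coset_shift _ gz); rewrite mulKVg.
    by rewrite !mulgA mulgK -mulgA; exact: zu.
  move=> /(phiK (x * (g * z (w^-1 * u)))%g); rewrite -mulgA mulKVg => ->.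
  by rewrite -[RHS](phiI _ _ gI) !mulgA mulgKV.
by apply: eq_bigr => u _; rewrite mulKg.
Qed.

(** Left invariance of [mu] absorbs the translation by g into the evaluation point, which becomes x
    g. Splitting over the fibres leaves the sum of a(u) phi(x g z_u), which vanishes. *)
Lemma ann_ind_translate (a : {ffun Gf -> R}) g :
  ann_ind_f k R a -> ann_ind mu (fun x => hecke_of_f a (g^-1 * x)%g).
Proof.
move=> aI; split=> [|f fI x]; first exact: hecke_of_f_hecke.
have /choice[z zu] := @coset_lift k F.
pose phi (y : G) := mu (fun t => \1_(@K1 k F) t * f (y * t)%g).
have hc g' u y : hecke (fun t => \1_(coset_K1 u) (g'^-1 * t)%g * f (y * t)%g).
  by apply: hecke_mul; [exact: hecke_coset | exact: ind_iwahori_lc].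
have hc1 u y : hecke (fun t => \1_(coset_K1 u) t * f (y * t)%g).
  by under eq_fun => t do rewrite -{1}[t]mul1g -{1}invg1; exact: hc.
rewrite /hecke_act -(haar_left_invariant hmu g); last first.
  by apply: hecke_mul; [exact: hecke_of_f_hecke | exact: ind_iwahori_lc].
under eq_fun do rewrite mulKg mulr_suml.
under eq_fun do under eq_bigr do rewrite -mulrA mulgA.
have [_ ->] := @hecke_sum _ (index_enum _) a _ (hc1 ^~ (x * g)%g).
rewrite -[RHS](@ann_ind_f_sum a phi z (x * g)%g aI).
(* The substitution t -> z_u t turns the integral over the fibre of u into one over K^1. *)
- apply: eq_bigr => u _; congr (_ * _).
  rewrite -(haar_left_invariant hmu (z u) (hc1 u _)); congr mu.
  apply/funext => t; rewrite !mulgA; congr (_ * _).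
  by apply: indic_iff; exact: coset_shift.
- move=> i y iI; congr mu; apply/funext => t.
  by rewrite -mulgA; congr (_ * _); case: fI => fI _ _; exact: fI.
- move=> y i iK.
  (* Right K^1-invariance of phi comes from the substitution t -> i t, which preserves K^1. *)
  rewrite /phi -[RHS](haar_left_invariant hmu i (hc1 1%g _)); congr mu.
  apply/funext => t; rewrite mulgA; congr (_ * _).
  by apply: indic_iff; split=> /coset_lK1; apply.
- exact: zu.
Qed.

(** Induction on the cosets gU covering the support of h. In the convolution at x, both h(y) and the
    inflation of a at y^-1 x are constant for y in gU, so this coset contributes a multiple of the
    translate by g. *)
Lemma ann_ind_convolution (a : {ffun Gf -> R}) h :
  ann_ind_f k R a -> hecke h -> ann_ind mu (convolution mu h (hecke_of_f a)).
Proof.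
move=> aI hh; have [n hn] := hecke_uniform hh.
have [s] := hecke_finite_support n hh.
elim: s => [|g s IHs] in h hh hn *.
  move=> h0; have -> : convolution mu h (hecke_of_f a) = fun=> 0.
    apply/funext => x; rewrite -[RHS]haar0; congr mu; apply/funext => y.
    have [->|/h0[]//] := eqVneq (h y) 0; by rewrite mul0r.
  exact: ann_ind0.
move=> hs; pose E := [set x | congr_subgroup n (g^-1 * x)%g].
have En (B : set G) : B = E \/ B = ~` E -> congr_invariant n (\1_B : G -> R).
  have Eiff x y : congr_subgroup n y -> E (x * y)%g <-> E x.
    move=> yn; rewrite /E /= mulgA; split=> [xy|xy].
      by rewrite -[(_ * x)%g](mulgK y); apply: congr_subgroupM => //;
        exact: congr_subgroupV.
    exact: congr_subgroupM.
  by move=> [] -> x y yn; apply: indic_iff; have := Eiff x y yn;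
    rewrite /setC /=; tauto.
have lE := congr_invariant_lc (En _ (or_introl (erefl _))).
have lnE := congr_invariant_lc (En _ (or_intror (erefl _))).
have hE : hecke (\1_E : G -> R).
  apply: (@hecke_lcoset n g); first by apply: En; left.
  move=> x; rewrite indicE; case: (boolP (_ \in _)) => [|_]; last by rewrite eqxx.
  by rewrite inE => /congr_subgroup_K1.
(* Removing gU from h leaves a function of the same level, supported on the remaining cosets. *)
pose h' x := h x * \1_(~` E) x.
have hh' : hecke h' by exact: hecke_mul.
have {}IHs : ann_ind mu (convolution mu h' (hecke_of_f a)).
  apply: IHs => // [x y yn|x]; first by rewrite /h' hn // En //; right.
  rewrite /h' mulf_eq0 negb_or => /andP[/hs[t]].
  rewrite inE => /orP[/eqP ->|ts tx _].
    by move=> gx; rewrite indicE memNset ?eqxx //; apply.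
  by exists t.
have lca x : locally_constant (fun y => hecke_of_f a (y^-1 * x)%g).
  apply: (@congr_invariant_lc 0) => y z zK.
  rewrite invMg -mulgA hecke_of_f_lK1 // -congr_subgroup0.
  exact: congr_subgroupV.
have -> : convolution mu h (hecke_of_f a) =
    fun x => (h g * mu (\1_E)) * hecke_of_f a (g^-1 * x)%g
             + convolution mu h' (hecke_of_f a) x; last first.
  by apply: ann_ind_lin => //; exact: ann_ind_translate.
apply/funext => x.
have -> : convolution mu h (hecke_of_f a) x =
    mu (fun y => h g * hecke_of_f a (g^-1 * x)%g * \1_E y
                 + h' y * hecke_of_f a (y^-1 * x)%g).
  congr mu; apply/funext => y; rewrite /h' !indicE in_setC.
  case: (boolP (y \in E)); rewrite ?mulr1 ?mulr0 ?mul0r ?addr0 ?add0r //.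
  (* With y = g(g^-1 y) and g^-1 y in U, invariance of h on the right and of the inflation on the
     left replaces y by g. *)
  rewrite inE => gy; rewrite -{1 2}(mulKVg g y) hn //; congr (_ * _).
  rewrite invMg -mulgA hecke_of_f_lK1 //.
  by apply: congr_subgroup_K1 (congr_subgroupV gy).
by rewrite (haar_linear hmu _ hE (hecke_mul hh' (lca x))) mulrAC.
Qed.

End Measure.
End HeckeAlgebra.

Theorem lemma5p4 (p q l : nat) (k : finFieldType) (F : nonarchLocalFieldType k)
    (R : closedFieldType)
    (hp : p \in [pchar k]) (hq : #|k| = q)
    (hl : l \in [pchar R]) (hlp : l != p) (hodd : odd l) (hdvd : (l %| q.+1)%N)
    (mu : (GL2 F -> R) -> R) (hmu : haar_measure mu) :
  parahoric_ind mu (ann_ind_f k R) `<=` ann_ind mu.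
Proof.
move=> _ [n [h [a [ha ->]]]]; apply: (ann_ind_sum hmu) => i.
by have [hh aI] := ha i; exact: ann_ind_convolution.
Qed.
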